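(* Let $S$ be a set, let $\mathbf{M}$ be an $S$-distributive monoidal category, and let $\mathbf{A},\mathbf{B}$ be $\mathbf{M}$-categories with object set $S$. Let $|\cdots|:S^3\to S$, $(x,y,z)\mapsto|xyz|$, be a function and let ${}_x\widetilde{R}_z^y:{}_xB_y\otimes{}_yA_z\to{}_xA_{|xyz|}\otimes{}_{|xyz|}B_z$ ($x,y,z\in S$) be morphisms in $\mathbf{M}$. Put ${}_xR_z^y:={}_x\sigma_z^{|xyz|}\circ{}_x\widetilde{R}_z^y$. Then $\{{}_xR_z^y\}_{x,y,z\in S}$ is a twisting system between $\mathbf{B}$ and $\mathbf{A}$ if and only if for all $x,y,z,t\in S$ the following four relations hold: $${}_x\sigma_t^{|xy|yzt||}\circ({}_xA_{|xy|yzt||}\otimes{}_{|xy|yzt||}b_t^{|yzt|})\circ({}_x\widetilde{R}_{|yzt|}^y\otimes{}_{|yzt|}B_t)\circ({}_xB_y\otimes{}_y\widetilde{R}_t^z)={}_x\sigma_t^{|xzt|}\circ{}_x\widetilde{R}_t^z\circ({}_xb_z^y\otimes{}_zA_t),$$ $${}_x\sigma_t^{||xyz|zt|}\circ({}_xa_{||xyz|zt|}^{|xyz|}\otimes{}_{||xyz|zt|}B_t)\circ({}_xA_{|xyz|}\otimes{}_{|xyz|}\widetilde{R}_t^z)\circ({}_x\widetilde{R}_z^y\otimes{}_zA_t)={}_x\sigma_t^{|xyt|}\circ{}_x\widetilde{R}_t^y\circ({}_xB_y\otimes{}_ya_t^z),$$ $${}_x\sigma_y^{|xxy|}\circ{}_x\widetilde{R}_y^x\circ(1_x^B\otimes{}_xA_y)={}_x\sigma_y^y\circ({}_xA_y\otimes1_y^B),$$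 $${}_x\sigma_y^{|xyy|}\circ{}_x\widetilde{R}_y^y\circ({}_xB_y\otimes1_y^A)={}_x\sigma_y^x\circ(1_x^A\otimes{}_xB_y).$$
   Context: $(\mathbf{M},\otimes,\mathbf{1})$ is a monoidal category; associativity and unit constraints are suppressed, and the identity morphism of an object $X$ is also denoted $X$. $\mathbf{M}$ is $S$-distributive if every $S$-indexed family $\{X_i\}_{i\in S}$ of objects has a coproduct $(\bigoplus_{i\in S}X_i,\{\sigma_i\}_{i\in S})$ and, for every object $X$, $(X\otimes\bigoplus_iX_i,\{X\otimes\sigma_i\})$ and $((\bigoplus_iX_i)\otimes X,\{\sigma_i\otimes X\})$ are coproducts of $\{X\otimes X_i\}$ and $\{X_i\otimes X\}$. An $\mathbf{M}$-category $\mathbf{A}$ with object set $S$ consists of objects ${}_xA_y$ of $\mathbf{M}$ (playing the role of $\mathrm{Hom}(y,x)$), composition morphisms ${}_xa_z^y:{}_xA_y\otimes{}_yA_z\to{}_xA_z$ and identities $1_x^A:\mathbf{1}\to{}_xA_x$, satisfying the usual associativity and unit axioms; for $\mathbf{B}$ the data are ${}_xB_y,{}_xb_z^y,1_x^B$. Write ${}_xA_{\overline{u}}B_y:=\bigoplus_{u\in S}{}_xA_u\otimes{}_uB_y$ with canonical inclusions ${}_x\sigma_y^u:{}_xA_u\otimes{}_uB_y\to{}_xA_{\overline{u}}B_y$. A twisting system between $\mathbf{B}$ and $\mathbf{A}$ is a family of morphisms ${}_xR_z^y:{}_xB_y\otimes{}_yA_z\to{}_xA_{\overline{u}}B_z$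 ($x,y,z\in S$) such that for all $x,y,z,t\in S$: (T1) ${}_xR_t^z\circ({}_xb_z^y\otimes{}_zA_t)=\mathsf{b}\circ\big(\bigoplus_{u}{}_xR_u^y\otimes{}_uB_t\big)\circ({}_xB_y\otimes{}_yR_t^z)$, where $\bigoplus_u{}_xR_u^y\otimes{}_uB_t:{}_xB_y\otimes\bigoplus_u({}_yA_u\otimes{}_uB_t)\to\bigoplus_{u,v}{}_xA_v\otimes{}_vB_u\otimes{}_uB_t$, and $\mathsf{b}:\bigoplus_{u,v}{}_xA_v\otimes{}_vB_u\otimes{}_uB_t\to{}_xA_{\overline{v}}B_t$ restricts to ${}_x\sigma_t^v\circ({}_xA_v\otimes{}_vb_t^u)$ on the $(u,v)$ summand; (T2) ${}_xR_t^y\circ({}_xB_y\otimes{}_ya_t^z)=\mathsf{a}\circ\big(\bigoplus_v{}_xA_v\otimes{}_vR_t^z\big)\circ({}_xR_z^y\otimes{}_zA_t)$, where $\bigoplus_v{}_xA_v\otimes{}_vR_t^z:\bigoplus_v{}_xA_v\otimes{}_vB_z\otimes{}_zA_t\to\bigoplus_{u,v}{}_xA_v\otimes{}_vA_u\otimes{}_uB_t$, and $\mathsf{a}:\bigoplus_{u,v}{}_xA_v\otimes{}_vA_u\otimes{}_uB_t\to{}_xA_{\overline{u}}B_t$ restricts to ${}_x\sigma_t^u\circ({}_xa_u^v\otimes{}_uB_t)$ on the $(u,v)$ summand; (T3) ${}_xR_y^x\circ(1_x^B\otimes{}_xA_y)={}_x\sigma_y^y\circ({}_xA_y\otimes1_y^B)$;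 (T4) ${}_xR_y^y\circ({}_xB_y\otimes1_y^A)={}_x\sigma_y^x\circ(1_x^A\otimes{}_xB_y)$. *)

(* Defs.v *)
Set Implicit Arguments.
Unset Strict Implicit.
Unset Printing Implicit Defensive.

Declare Scope mon_scope.
Delimit Scope mon_scope with mon.
Local Open Scope mon_scope.

Reserved Notation "g ∘ f" (at level 40, left associativity).
Reserved Notation "X ⊗ Y" (at level 34, left associativity).
Reserved Notation "f ⊗₁ g" (at level 34, left associativity).
Reserved Notation "X ◁ f" (at level 34, no associativity).
Reserved Notation "f ▷ X" (at level 34, no associativity).

Record category := Category {
  ob :> Type;
  hom : ob -> ob -> Type;
  idm : forall X : ob, hom X X;
  comp : forall X Y Z : ob, hom Y Z -> hom X Y -> hom X Z;
  compA : forall (W X Y Z : ob) (h : hom Y Z) (g : hom X Y) (f : hom W X),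
    comp h (comp g f) = comp (comp h g) f;
  comp_idl : forall (X Y : ob) (f : hom X Y), comp (idm Y) f = f;
  comp_idr : forall (X Y : ob) (f : hom X Y), comp f (idm X) = f
}.

Arguments hom {c} X Y.
Arguments idm {c} X.
Arguments comp {c X Y Z} g f : rename.

Notation "g ∘ f" := (comp g f) : mon_scope.

(* Not assumed strict: [assoc] is (X ⊗ Y) ⊗ Z -> X ⊗ (Y ⊗ Z), [lunit] is
   1 ⊗ X -> X and [runit] is X ⊗ 1 -> X, each with a two-sided inverse. *)
Record monoidal_category := MonoidalCategory {
  mcat :> category;
  tens : mcat -> mcat -> mcat;
  tensm : forall X X' Y Y' : mcat,
    hom X X' -> hom Y Y' -> hom (tens X Y) (tens X' Y');
  tens_id : forall X Y : mcat, tensm (idm X) (idm Y) = idm (tens X Y);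
  tens_comp : forall (X X' X'' Y Y' Y'' : mcat)
      (f' : hom X' X'') (f : hom X X') (g' : hom Y' Y'') (g : hom Y Y'),
    tensm (f' ∘ f) (g' ∘ g) = tensm f' g' ∘ tensm f g;
  munit : mcat;
  assoc : forall X Y Z : mcat, hom (tens (tens X Y) Z) (tens X (tens Y Z));
  assoc_inv : forall X Y Z : mcat, hom (tens X (tens Y Z)) (tens (tens X Y) Z);
  assocK : forall X Y Z : mcat, assoc_inv X Y Z ∘ assoc X Y Z = idm _;
  assoc_invK : forall X Y Z : mcat, assoc X Y Z ∘ assoc_inv X Y Z = idm _;
  assoc_nat : forall (X X' Y Y' Z Z' : mcat)
      (f : hom X X') (g : hom Y Y') (h : hom Z Z'),
    assoc X' Y' Z' ∘ tensm (tensm f g) h = tensm f (tensm g h) ∘ assoc X Y Z;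
  lunit : forall X : mcat, hom (tens munit X) X;
  lunit_inv : forall X : mcat, hom X (tens munit X);
  lunitK : forall X : mcat, lunit_inv X ∘ lunit X = idm _;
  lunit_invK : forall X : mcat, lunit X ∘ lunit_inv X = idm _;
  lunit_nat : forall (X Y : mcat) (f : hom X Y),
    lunit Y ∘ tensm (idm munit) f = f ∘ lunit X;
  runit : forall X : mcat, hom (tens X munit) X;
  runit_inv : forall X : mcat, hom X (tens X munit);
  runitK : forall X : mcat, runit_inv X ∘ runit X = idm _;
  runit_invK : forall X : mcat, runit X ∘ runit_inv X = idm _;
  runit_nat : forall (X Y : mcat) (f : hom X Y),
    runit Y ∘ tensm f (idm munit) = f ∘ runit X;
  triangle : forall X Y : mcat,
    tensm (idm X) (lunit Y) ∘ assoc X munit Y = tensm (runit X) (idm Y);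
  pentagon : forall W X Y Z : mcat,
    assoc W X (tens Y Z) ∘ assoc (tens W X) Y Z =
    tensm (idm W) (assoc X Y Z) ∘ assoc W (tens X Y) Z
      ∘ tensm (assoc W X Y) (idm Z)
}.

Arguments tens {m} X Y : rename.
Arguments tensm {m X X' Y Y'} f g : rename.
Arguments munit {m}.
Arguments assoc {m} X Y Z.
Arguments assoc_inv {m} X Y Z.
Arguments lunit {m} X.
Arguments lunit_inv {m} X.
Arguments runit {m} X.
Arguments runit_inv {m} X.

Notation "X ⊗ Y" := (tens X Y) : mon_scope.
Notation "f ⊗₁ g" := (tensm f g) : mon_scope.
Notation "X ◁ f" := (tensm (idm X) f) : mon_scope.
Notation "f ▷ X" := (tensm f (idm X)) : mon_scope.

(* The mediating morphism is determined by the last two fields; it is kept as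
   data so that it can be used in definitions without a choice principle. *)
Record is_coproduct (C : category) (I : Type) (X : I -> C) (P : C)
    (inj : forall i, hom (X i) P) := IsCoproduct {
  copair : forall Y : C, (forall i, hom (X i) Y) -> hom P Y;
  copairE : forall (Y : C) (f : forall i, hom (X i) Y) (i : I),
    copair f ∘ inj i = f i;
  copair_uniq : forall (Y : C) (f : forall i, hom (X i) Y) (h : hom P Y),
    (forall i, h ∘ inj i = f i) -> h = copair f
}.

Arguments copair {C I X P inj} PX {Y} f : rename.

Record distributive (S : Type) (M : monoidal_category) := Distributive {
  bigsum : (S -> M) -> M;
  sinj : forall (X : S -> M) (i : S), hom (X i) (bigsum X);
  sumP : forall X : S -> M, is_coproduct (sinj X);
  tens_sumP : forall (Y : M) (X : S -> M),
    is_coproduct (X := fun i => Y ⊗ X i) (P := Y ⊗ bigsum X)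
      (fun i => Y ◁ sinj X i);
  sum_tensP : forall (X : S -> M) (Y : M),
    is_coproduct (X := fun i => X i ⊗ Y) (P := bigsum X ⊗ Y)
      (fun i => sinj X i ▷ Y)
}.

Arguments bigsum {S M} D X : rename.
Arguments sinj {S M} D X i : rename.
Arguments sumP {S M} D X : rename.
Arguments tens_sumP {S M} D Y X : rename.
Arguments sum_tensP {S M} D X Y : rename.

Section Sums.
Variables (S : Type) (M : monoidal_category) (D : distributive S M).

(* The S × S-indexed coproduct, as an iterated one; the first index is the
   outer one. *)
Definition bigsum2 (X : S -> S -> M) : M := bigsum D (fun i => bigsum D (X i)).

Definition copair2 (X : S -> S -> M) (Y : M) (f : forall i j, hom (X i j) Y) :
    hom (bigsum2 X) Y :=
  copair (sumP D _) (fun i => copair (sumP D (X i)) (f i)).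

Definition distrl (Y : M) (X : S -> M) :
    hom (Y ⊗ bigsum D X) (bigsum D (fun i => Y ⊗ X i)) :=
  copair (tens_sumP D Y X) (fun i => sinj D (fun i => Y ⊗ X i) i).

Definition distrr (X : S -> M) (Y : M) :
    hom (bigsum D X ⊗ Y) (bigsum D (fun i => X i ⊗ Y)) :=
  copair (sum_tensP D X Y) (fun i => sinj D (fun i => X i ⊗ Y) i).

End Sums.

(* [mhom A x y] is the object written xAy (thus "Hom(y, x)"), and
   [mcomp A x y z : xAy ⊗ yAz -> xAz] takes its middle index second. *)
Record mcategory (S : Type) (M : monoidal_category) := MCategory {
  mhom : S -> S -> M;
  mcomp : forall x y z : S, hom (mhom x y ⊗ mhom y z) (mhom x z);
  mone : forall x : S, hom munit (mhom x x);
  mcompA : forall x y z t : S,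
    mcomp x z t ∘ (mcomp x y z ▷ mhom z t) =
    mcomp x y t ∘ (mhom x y ◁ mcomp y z t)
      ∘ assoc (mhom x y) (mhom y z) (mhom z t);
  mcomp1l : forall x y : S,
    mcomp x x y ∘ (mone x ▷ mhom x y) = lunit (mhom x y);
  mcomp1r : forall x y : S,
    mcomp x y y ∘ (mhom x y ◁ mone y) = runit (mhom x y)
}.

Arguments mhom {S M} A x y : rename.
Arguments mcomp {S M} A x y z : rename.
Arguments mone {S M} A x : rename.

Section Twisting.
Variables (S : Type) (M : monoidal_category) (D : distributive S M).
Variables A B : mcategory S M.

Definition sumAB (x y : S) : M := bigsum D (fun u => mhom A x u ⊗ mhom B u y).

Definition sigma (x u y : S) : hom (mhom A x u ⊗ mhom B u y) (sumAB x y) :=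
  sinj D (fun u => mhom A x u ⊗ mhom B u y) u.

(* [R x y z] has source xBy ⊗ yAz, as does [Rt x y z] in the theorem. *)
Variable R : forall x y z : S, hom (mhom B x y ⊗ mhom A y z) (sumAB x z).

Definition sumABB (x t : S) : M :=
  bigsum2 D (fun u v => (mhom A x v ⊗ mhom B v u) ⊗ mhom B u t).

Definition sumAAB (x t : S) : M :=
  bigsum2 D (fun v u => mhom A x v ⊗ (mhom A v u ⊗ mhom B u t)).

Definition sumRB (x y t : S) : hom (mhom B x y ⊗ sumAB y t) (sumABB x t) :=
  copair (tens_sumP D (mhom B x y) (fun u => mhom A y u ⊗ mhom B u t))
    (fun u =>
       sinj D (fun u => bigsum D
                 (fun v => (mhom A x v ⊗ mhom B v u) ⊗ mhom B u t)) u
       ∘ distrr D (fun v => mhom A x v ⊗ mhom B v u) (mhom B u t)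
       ∘ (R x y u ▷ mhom B u t)
       ∘ assoc_inv (mhom B x y) (mhom A y u) (mhom B u t)).

Definition sumb (x t : S) : hom (sumABB x t) (sumAB x t) :=
  copair2 D (fun u v =>
    sigma x v t ∘ (mhom A x v ◁ mcomp B v u t)
      ∘ assoc (mhom A x v) (mhom B v u) (mhom B u t)).

Definition sumAR (x z t : S) : hom (sumAB x z ⊗ mhom A z t) (sumAAB x t) :=
  copair (sum_tensP D (fun v => mhom A x v ⊗ mhom B v z) (mhom A z t))
    (fun v =>
       sinj D (fun v => bigsum D
                 (fun u => mhom A x v ⊗ (mhom A v u ⊗ mhom B u t))) v
       ∘ distrl D (mhom A x v) (fun u => mhom A v u ⊗ mhom B u t)
       ∘ (mhom A x v ◁ R v z t)
       ∘ assoc (mhom A x v) (mhom B v z) (mhom A z t)).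

Definition suma (x t : S) : hom (sumAAB x t) (sumAB x t) :=
  copair2 D (fun v u =>
    sigma x u t ∘ (mcomp A x v u ▷ mhom B u t)
      ∘ assoc_inv (mhom A x v) (mhom A v u) (mhom B u t)).

Record twisting_system : Prop := TwistingSystem {
  twist_mulB : forall x y z t : S,
    R x z t ∘ (mcomp B x y z ▷ mhom A z t) =
    sumb x t ∘ sumRB x y t ∘ (mhom B x y ◁ R y z t)
      ∘ assoc (mhom B x y) (mhom B y z) (mhom A z t);
  twist_mulA : forall x y z t : S,
    R x y t ∘ (mhom B x y ◁ mcomp A y z t)
      ∘ assoc (mhom B x y) (mhom A y z) (mhom A z t) =
    suma x t ∘ sumAR x z t ∘ (R x y z ▷ mhom A z t);
  twist_oneB : forall x y : S,
    R x x y ∘ (mone B x ▷ mhom A x y) ∘ lunit_inv (mhom A x y) =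
    sigma x y y ∘ (mhom A x y ◁ mone B y) ∘ runit_inv (mhom A x y);
  twist_oneA : forall x y : S,
    R x y y ∘ (mhom B x y ◁ mone A y) ∘ runit_inv (mhom B x y) =
    sigma x x y ∘ (mone A x ▷ mhom B x y) ∘ lunit_inv (mhom B x y)
}.

End Twisting.

Arguments twisting_system {S M} D A B R.

(* Main.v *)
(* On the canonical inclusions the composites in (T1) and (T2) are given by
   the universal properties of the coproducts. Since each [R] factors through a
   single inclusion, evaluating them there leaves exactly the first two
   relations; the other two are (T3) and (T4) themselves. *)

Require Import Defs.
Local Open Scope mon_scope.

Section Whiskering.
Context {M : monoidal_category}.

Lemma whisker_left_comp (W X Y Z : M) (g : hom Y Z) (f : hom X Y) :
  W ◁ (g ∘ f) = (W ◁ g) ∘ (W ◁ f).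
Proof. now rewrite <- tens_comp, comp_idl. Qed.

Lemma whisker_right_comp (W X Y Z : M) (g : hom Y Z) (f : hom X Y) :
  (g ∘ f) ▷ W = (g ▷ W) ∘ (f ▷ W).
Proof. now rewrite <- tens_comp, comp_idl. Qed.

End Whiskering.

Section Sums.
Context {S : Type} {M : monoidal_category} (D : distributive S M).

Lemma distrl_sinj (Y : M) (X : S -> M) (i : S) :
  distrl D Y X ∘ (Y ◁ sinj D X i) = sinj D (fun i => Y ⊗ X i) i.
Proof. exact (copairE (tens_sumP D Y X) _ i). Qed.

Lemma distrr_sinj (X : S -> M) (Y : M) (i : S) :
  distrr D X Y ∘ (sinj D X i ▷ Y) = sinj D (fun i => X i ⊗ Y) i.
Proof. exact (copairE (sum_tensP D X Y) _ i). Qed.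

Lemma copair2_sinj (X : S -> S -> M) (Y : M)
    (f : forall i j, hom (X i j) Y) (i j : S) :
  copair2 D f ∘ sinj D (fun i => bigsum D (X i)) i ∘ sinj D (X i) j = f i j.
Proof.
unfold copair2.
rewrite (copairE (sumP D (fun i => bigsum D (X i)))).
apply copairE.
Qed.

End Sums.

Section Composites.
Context {S : Type} {M : monoidal_category} (D : distributive S M).
Context (A B : mcategory S M).
Variable R : forall x y z : S, hom (mhom B x y ⊗ mhom A y z) (sumAB D A B x z).

(** Only the component [R x y u] meets the summand at [u]. As it lands in the single summand at [v],
    distributing [mhom B u t] over the sum puts it in the summand indexed by [u] and [v], where
    [sumb] is prescribed; the other components of [R] may be arbitrary. *)
Lemma sumb_sumRB_sigma (x y u v t : S)
    (r : hom (mhom B x y ⊗ mhom A y u) (mhom A x v ⊗ mhom B v u)) :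
  R x y u = sigma D A B x v u ∘ r ->
  sumb D A B x t ∘ sumRB R x y t ∘ (mhom B x y ◁ sigma D A B y u t) =
  sigma D A B x v t ∘ (mhom A x v ◁ mcomp B v u t)
    ∘ assoc (mhom A x v) (mhom B v u) (mhom B u t)
    ∘ (r ▷ mhom B u t)
    ∘ assoc_inv (mhom B x y) (mhom A y u) (mhom B u t).
Proof.
intro Rr.
unfold sumRB; rewrite <- compA.
(* The ascription restates the inclusion as [sigma], which is only convertible to [sinj], so that
   the rewrite finds it in the goal. *)
rewrite (copairE (tens_sumP D _ (fun u => mhom A y u ⊗ mhom B u t)) _ u
  : _ ∘ (_ ◁ sigma D A B y u t) = _).
rewrite Rr, whisker_right_comp, !compA.
rewrite <- (compA (sumb D A B x t ∘ _)).
rewrite (distrr_sinj D (fun v => mhom A x v ⊗ mhom B v u) (mhom B u t) v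
  : _ ∘ (sigma D A B x v u ▷ _) = _).
unfold sumb, sumABB.
rewrite (copair2_sinj D (fun u v => (mhom A x v ⊗ mhom B v u) ⊗ mhom B u t)).
reflexivity.
Qed.

(** Mirror image of [sumb_sumRB_sigma]: here [mhom A x v] is distributed from the left, and [v] is
    the outer index of the double sum. *)
Lemma suma_sumAR_sigma (x v u z t : S)
    (r : hom (mhom B v z ⊗ mhom A z t) (mhom A v u ⊗ mhom B u t)) :
  R v z t = sigma D A B v u t ∘ r ->
  suma D A B x t ∘ sumAR R x z t ∘ (sigma D A B x v z ▷ mhom A z t) =
  sigma D A B x u t ∘ (mcomp A x v u ▷ mhom B u t)
    ∘ assoc_inv (mhom A x v) (mhom A v u) (mhom B u t)
    ∘ (mhom A x v ◁ r)
    ∘ assoc (mhom A x v) (mhom B v z) (mhom A z t).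
Proof.
intro Rr.
unfold sumAR; rewrite <- compA.
rewrite (copairE (sum_tensP D (fun v => mhom A x v ⊗ mhom B v z) _) _ v
  : _ ∘ (sigma D A B x v z ▷ _) = _).
rewrite Rr, whisker_left_comp, !compA.
rewrite <- (compA (suma D A B x t ∘ _)).
rewrite (distrl_sinj D (mhom A x v) (fun u => mhom A v u ⊗ mhom B u t) u
  : _ ∘ (_ ◁ sigma D A B v u t) = _).
unfold suma, sumAAB.
rewrite (copair2_sinj D (fun v u => mhom A x v ⊗ (mhom A v u ⊗ mhom B u t))).
reflexivity.
Qed.

End Composites.

Theorem proposition2p5 (S : Type) (M : monoidal_category)
    (D : distributive S M) (A B : mcategory S M) (m : S -> S -> S -> S)
    (Rt : forall x y z : S,
       hom (mhom B x y ⊗ mhom A y z)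
           (mhom A x (m x y z) ⊗ mhom B (m x y z) z)) :
  twisting_system D A B
    (fun x y z => sigma D A B x (m x y z) z ∘ Rt x y z) <->
  (forall x y z t : S,
    (let w := m y z t in
     let v := m x y w in
     sigma D A B x v t
       ∘ (mhom A x v ◁ mcomp B v w t)
       ∘ assoc (mhom A x v) (mhom B v w) (mhom B w t)
       ∘ (Rt x y w ▷ mhom B w t)
       ∘ assoc_inv (mhom B x y) (mhom A y w) (mhom B w t)
       ∘ (mhom B x y ◁ Rt y z t)
       ∘ assoc (mhom B x y) (mhom B y z) (mhom A z t) =
     sigma D A B x (m x z t) t ∘ Rt x z t
       ∘ (mcomp B x y z ▷ mhom A z t)) /\
    (let v := m x y z in
     let u := m v z t in
     sigma D A B x u t
       ∘ (mcomp A x v u ▷ mhom B u t)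
       ∘ assoc_inv (mhom A x v) (mhom A v u) (mhom B u t)
       ∘ (mhom A x v ◁ Rt v z t)
       ∘ assoc (mhom A x v) (mhom B v z) (mhom A z t)
       ∘ (Rt x y z ▷ mhom A z t) =
     sigma D A B x (m x y t) t ∘ Rt x y t
       ∘ (mhom B x y ◁ mcomp A y z t)
       ∘ assoc (mhom B x y) (mhom A y z) (mhom A z t)) /\
    sigma D A B x (m x x y) y ∘ Rt x x y
      ∘ (mone B x ▷ mhom A x y) ∘ lunit_inv (mhom A x y) =
    sigma D A B x y y ∘ (mhom A x y ◁ mone B y) ∘ runit_inv (mhom A x y) /\
    sigma D A B x (m x y y) y ∘ Rt x y y
      ∘ (mhom B x y ◁ mone A y) ∘ runit_inv (mhom B x y) =
    sigma D A B x x y ∘ (mone A x ▷ mhom B x y) ∘ lunit_inv (mhom B x y)).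
Proof.
pose (R := fun x y z => sigma D A B x (m x y z) z ∘ Rt x y z).
(* Only the outer [R] is split into inclusion and [Rt]; the one inside [sumRB] stays folded, so that
   [sumb_sumRB_sigma] applies to the part before [Rt]. *)
assert (mulB : forall x y z t,
  sumb D A B x t ∘ sumRB R x y t ∘ (mhom B x y ◁ R y z t) =
  sumb D A B x t ∘ sumRB R x y t
    ∘ (mhom B x y ◁ sigma D A B y (m y z t) t) ∘ (mhom B x y ◁ Rt y z t)).
{ intros; unfold R at 2; now rewrite whisker_left_comp, !compA. }
assert (mulA : forall x y z t,
  suma D A B x t ∘ sumAR R x z t ∘ (R x y z ▷ mhom A z t) =
  suma D A B x t ∘ sumAR R x z t
    ∘ (sigma D A B x (m x y z) z ▷ mhom A z t) ∘ (Rt x y z ▷ mhom A z t)).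
{ intros; unfold R at 2; now rewrite whisker_right_comp, !compA. }
split.
- intros [T1 T2 T3 T4] x y z t; cbv zeta.
  repeat split.
  + rewrite T1, mulB.
    (* The factorization of [R] holds by unfolding, so [eq_refl] proves it and unification finds
       [v := m x y (m y z t)] and [r := Rt x y (m y z t)]. *)
    now rewrite (sumb_sumRB_sigma D A B R _ _ _ _ _ _ eq_refl).
  + rewrite T2, mulA.
    now rewrite (suma_sumAR_sigma D A B R _ _ _ _ _ _ eq_refl).
  + apply T3.
  + apply T4.
- intro H; split; intros x y.
  + intros z t; destruct (H x y z t) as [E _].
    rewrite <- E, mulB.
    now rewrite (sumb_sumRB_sigma D A B R _ _ _ _ _ _ eq_refl).
  + intros z t; destruct (H x y z t) as [_ [E _]].
    rewrite <- E, mulA.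
    now rewrite (suma_sumAR_sigma D A B R _ _ _ _ _ _ eq_refl).
  (* The unit relations involve only two objects; [x] and [y] are repeated merely to fill the places
     of [z] and [t]. *)
  + apply (H x y x y).
  + apply (H x y x y).
Qed.
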